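(* Let $p\ne2$ be a prime, and let $n\ge 1$, $l\ge1$ be integers. (1) Let $C\in\mathbb{Z}^{n\times n}$, $r=\operatorname{rk}(C \bmod p)$, $r_\infty=\operatorname{rk}_\infty(C\bmod p)$. Then $$N^*(C,C;p^l)\le 2^{r_\infty}p^{e(l,n,r,r_\infty)},$$ where $$e(l,n,r,r_\infty)=(n-r)^2+(r-r_\infty)^2+r_\infty^2/2+(l-1)\big((n-r)(n-r_\infty)+r_\infty^2/2\big).$$ (2) Let $A,B\in\mathbb{Z}^{n\times n}$ and assume that $r=\operatorname{rk}(A\bmod p)=\operatorname{rk}(B\bmod p)>0$. Then $$N^*(A,B;p^l)\le 2^r\begin{cases}p^{ln(n-r)} & \text{if } r\le n/2,\\ p^{ln^2/2} & \text{if } n/2<r\le n.\end{cases}$$ (3) In particular, let $A,B\in\mathbb{Z}^{n\times n}$. If $n>1$ and $\gcd(A,B,p)=1$ (i.e. $p$ does not divide all the entries of both $A$ and $B$), then $N^*(A,B;p^l)\le 2^np^{l(n^2-n)}$. If $\gcd(\det A,\det B,p)=1$, then $N^*(A,B;p^l)\le 2^np^{ln^2/2}$.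
   Context: For $A,B\in\mathbb{Z}^{n\times n}$, $N^*(A,B;p^l)=\#\{X\in GL_n(\mathbb{Z}/p^l\mathbb{Z})\mid AX\equiv X^{-1}B \pmod{p^l}\}$. The stable rank of a square matrix $M$ over a field is $\operatorname{rk}_\infty M=\lim_{m\to\infty}\operatorname{rk}M^m$. *)

(* Defs.v *)
From HB Require Import structures.
From mathcomp Require Import all_boot all_order all_algebra.
From mathcomp Require Import all_classical all_reals all_analysis.
Set Implicit Arguments.
Unset Strict Implicit.
Unset Printing Implicit Defensive.
Import Order.TTheory GRing.Theory Num.Theory.
Import numFieldNormedType.Exports.
Local Open Scope ring_scope.

(* 'Z_q is the ring Z/qZ only for 1 < q; below q = p ^ l with p prime, 0 < l. *)
Definition Nstar (n : nat) (A B : 'M[int]_n) (q : nat) : nat :=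
  #|[set X : 'M['Z_q]_n | (X \in unitmx)
       && (map_mx intr A *m X == invmx X *m map_mx intr B)]|.

Definition mx_modp (p n : nat) (A : 'M[int]_n) : 'M['F_p]_n := map_mx intr A.

(* The limit is taken in nat, whose topology is discrete. *)
Definition stable_rank (F : fieldType) (n : nat) (M : 'M[F]_n) : nat :=
  lim ((fun m : nat => \rank (M ^+ m)) @ \oo)%classic.

Definition exponent_e (R : realType) (l n r r_oo : nat) : R :=
  (n%:R - r%:R) ^+ 2 + (r%:R - r_oo%:R) ^+ 2 + r_oo%:R ^+ 2 / 2
  + (l%:R - 1) * ((n%:R - r%:R) * (n%:R - r_oo%:R) + r_oo%:R ^+ 2 / 2).

(* Main.v *)
Require Import Defs.
From HB Require Import structures.
From mathcomp Require Import all_boot all_order all_algebra.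
From mathcomp Require Import all_classical all_reals all_analysis.
From mathcomp Require Import ring zify.
Set Implicit Arguments.
Unset Strict Implicit.
Unset Printing Implicit Defensive.
Import Order.TTheory GRing.Theory Num.Theory.
Import numFieldNormedType.Exports.
Local Open Scope ring_scope.

(** Because [X] is invertible, [A X = X^-1 B] says [X A X = B].  If [X0] is one
    solution then [X = Y X0] is another exactly when [Y C Y = C] with
    [C = X0 A], a matrix of the same rank as [A] modulo [p].  So all three parts
    are about the equation [X C X = C], with [r] the rank and [s] the stable rank
    of [C] modulo [p].

    Lifting.  Two solutions modulo [p^(l+1)] that agree modulo [p^l] differ by
    [p^l D], and expanding gives [D C X + X C D = 0] modulo [p]: the matrix
    [X^-1 D] anticommutes with [M = C X].  As [M^2 = C (X C X) = C^2], the matrix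
    [M] has rank [r] and stable rank [s] too.  Hence each of the [l - 1] lifting
    steps costs at most the number of matrices over [F_p] that anticommute with
    some such [M] ([anticomm_of_lift], [card_zsol_step]).

    Over a finite field with [q] elements, both the solutions of [X C X = C] and
    the matrices anticommuting with [M] preserve the image of the given matrix.
    Restricting to that image loses a factor [q^((n-r)^2)] and replaces [C] by a
    matrix of size [r] with the same stable rank ([image_reduction]).  Iterating,
    the ranks of the powers of [C] drop by steps [n - r = d_1 >= d_2 >= ...] with
    sum [n - s], and the total loss [q^(d_1^2 + d_2^2 + ...)] is at most
    [q^((n-r)(n-s))]; separating the first step from the others it is also at
    most [q^((n-r)^2 + (r-s)^2)].  What remains is an invertible matrix of size [s].

    For invertible [C] put [Y = C X]: then [Y^2 = C^2], and [k x k] matrices have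
    at most [2^k q^(k^2/2)] square roots ([max_sqroots_bound]).  An invertible
    [M] of size [k] has at most [q^(k^2/2)] anticommuting matrices
    ([card_anticomm_unit]).  Both follow by induction on [k] from an eigenvector
    over the ground field; when there is none, every cyclic submodule of a
    quotient has dimension at least 2, so [k/2] vectors generate the space and a
    matrix intertwining two actions is determined by their images
    ([card_intertwiners]).

    These estimates give the first part.  For the second it is enough to bound
    [2 (n-r)(n-s) + s^2] by [2 n (n-r)] or by [n^2], according to the size of [r]
    ([exponent_small_rank], [exponent_large_rank]), and the third is a special
    case of this.  Half-integral exponents are avoided up to the very end by
    bounding the squares of the counts. *)

(** * Counting by fibres *)
Lemma card_le_fibers (T U : finType) (A : {set T}) (B : {set U}) (f : T -> U)
    (N : nat) :
  (forall x, x \in A -> f x \in B) ->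
  (forall y, y \in B -> (#|[set x in A | f x == y]| <= N)%N) ->
  (#|A| <= #|B| * N)%N.
Proof.
move=> fAB fib; rewrite -sum1_card.
rewrite (partition_big f (mem B)) => [|x /fAB //].
rewrite -sum_nat_const; apply: leq_sum => y By.
by rewrite -[X in (_ <= X)%N]muln1 sum1dep_card muln1; apply: fib.
Qed.

(** The working form of fibre counting for solution sets: two points of a fibre
    differ by a solution of the homogeneous equation. *)
Lemma card_le_translates (T : finZmodType) (U : finType) (A K : {set T})
    (B : {set U}) (f : T -> U) :
  (forall x, x \in A -> f x \in B) ->
  (forall x y, x \in A -> y \in A -> f x = f y -> x - y \in K) ->
  (#|A| <= #|B| * #|K|)%N.
Proof.
move=> fAB fK; apply: (card_le_fibers fAB) => y _.
have [->|[x0]] := set_0Vmem [set x in A | f x == y]; first by rewrite cards0.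
rewrite inE => /andP[Ax0 /eqP fx0].
rewrite -(card_imset _ (addIr (- x0))); apply/subset_leq_card/fintype.subsetP=> z.
case/imsetP=> x; rewrite inE => /andP[Ax /eqP fx] ->.
by apply: fK => //; rewrite fx fx0.
Qed.

Lemma card_le_inj (T U : finType) (A : {set T}) (B : {set U}) (f : T -> U) :
  (forall x, x \in A -> f x \in B) ->
  (forall x y, x \in A -> y \in A -> f x = f y -> x = y) ->
  (#|A| <= #|B|)%N.
Proof.
move=> fAB fI; rewrite -(card_in_imset fI); apply/subset_leq_card/fintype.subsetP=> y.
by case/imsetP=> x Ax ->; apply: fAB.
Qed.

(** * Linear equations and bases over a finite field *)
Section FiniteFieldMatrices.
Variable F : finFieldType.
Local Notation q := #|F|.

Lemma expq_gt0 (n : nat) : (0 < q ^ n)%N.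
Proof. by rewrite expn_gt0 ltnW // (card_finNzRing_gt1 F). Qed.

Lemma expq_leq (m n : nat) : (m <= n)%N -> (q ^ m <= q ^ n)%N.
Proof. by move=> le_mn; rewrite leq_pexp2l // ltnW // (card_finNzRing_gt1 F). Qed.

Lemma card_left_kernel (m n k : nat) (A : 'M[F]_(n, k)) :
  (#|[set X : 'M[F]_(m, n) | X *m A == 0%R]| <= q ^ (m * (n - \rank A)))%N.
Proof.
rewrite -(mxrank_ker A) -card_mx -cardsT.
apply: (@card_le_inj _ _ _ _ (fun X => X *m pinvmx (row_base (kermx A)))).
  by move=> X _; rewrite inE.
move=> X Y; rewrite !inE => /eqP XA /eqP YA /(congr1 (mulmx^~ (row_base (kermx A)))).
by rewrite /= !mulmxKpV // eq_row_base; apply/sub_kermxP.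
Qed.

Lemma card_right_kernel (m n k : nat) (A : 'M[F]_(n, k)) :
  (#|[set X : 'M[F]_(k, m) | A *m X == 0%R]| <= q ^ (m * (k - \rank A)))%N.
Proof.
rewrite -mxrank_tr; apply: leq_trans (card_left_kernel m A^T).
apply: (@card_le_inj _ _ _ _ trmx) => [X|X Y _ _ /trmx_inj //].
by rewrite !inE -trmx_mul => /eqP->; rewrite trmx0.
Qed.

Lemma eq_rank_basis (k n w : nat) (W : 'M[F]_(k, n)) :
  \rank W = w -> exists2 B : 'M[F]_(w, n), row_free B & (B :=: W)%MS.
Proof. by case: w /; exists (row_base W); [apply: row_base_free|apply: eq_row_base]. Qed.

Lemma complete_row_free (w u : nat) (B : 'M[F]_(w, w + u)) :
  row_free B -> exists C : 'M[F]_(u, w + u), col_mx B C \in unitmx.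
Proof.
move=> fB; have rC : \rank (B^C)%MS = u.
  by rewrite mxrank_compl (eqP fB) addKn.
have [C _ eC] := eq_rank_basis rC.
exists C; rewrite -row_full_unit -col_leq_rank -addsmxE.
rewrite (adds_eqmx (eqmx_refl B) eC).
by rewrite col_leq_rank; apply: addsmx_compl_full.
Qed.

(** [usubmx P] is a basis of the stable subspace: a row-stable subspace shows up
    as a zero upper right block. *)
Lemma conj_stable (w u : nat) (P Y : 'M[F]_(w + u)) Y1 :
  P \in unitmx -> usubmx P *m Y = Y1 *m usubmx P ->
  usubmx (P *m Y *m invmx P) = row_mx Y1 0.
Proof.
move=> uP PY; rewrite -!mul_usub_mx PY -mulmxA mul_usub_mx mulmxV //.
by rewrite (scalar_mx_block _ _ 1) /block_mx col_mxKu mul_mx_row mulmx1 mulmx0.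
Qed.

End FiniteFieldMatrices.

(** * Intertwiners of a matrix without eigenvectors *)
Section Intertwiners.
Variable F : finFieldType.
Local Notation q := #|F|.

(** If [W] were [U] plus the line of [v], then [v] would be an eigenvector of [M]
    on the quotient by [U]; but [M - a] is bijective on the whole space and on
    [U], hence also on the quotient. *)
Lemma stablemx_rank_jump (k : nat) (M U W : 'M[F]_k) (v : 'rV_k) :
  (forall a, M - a%:M \in unitmx) -> stablemx U M -> stablemx W M ->
  (U <= W)%MS -> (v <= W)%MS -> ~~ (v <= U)%MS -> (\rank U + 2 <= \rank W)%N.
Proof.
move=> noeig sU sW UW vW; apply: contraNleq => ltW.
have UvW : (U + v <= W)%MS by rewrite addsmx_sub UW.
have [|ltU] := leqP (\rank (U + v)%MS) (\rank U).
  rewrite (geq_leqif (mxrank_leqif_sup (addsmxSl U v))) addsmx_sub => /andP[] //.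
have WUv : (W <= U + v)%MS.
  by rewrite -(geq_leqif (mxrank_leqif_sup UvW)); lia.
have: (v *m M <= U + v)%MS by rewrite (submx_trans _ WUv) // (submx_trans _ sW) // submxMr.
case/sub_addsmxP=> -[x y] /= vM.
have [a ya] : exists a, y *m v = a *: v.
  by exists (y 0 0); rewrite [y in LHS]mx11_scalar mul_scalar_mx.
have va : v *m (M - a%:M) = x *m U.
  by rewrite mulmxBr vM ya mul_mx_scalar addrK.
have sUa : (U *m (M - a%:M) <= U)%MS.
  by rewrite mulmxBr addmx_sub // eqmx_opp mul_mx_scalar scalemx_sub.
have : (U <= U *m (M - a%:M))%MS.
  by rewrite -(geq_leqif (mxrank_leqif_sup sUa)) mxrankMfree // row_free_unit.
case/submxP=> D /(congr1 (mulmx x)); rewrite -va !mulmxA => /(can_inj (mulmxK (noeig a))) ->.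
exact: submxMl.
Qed.

(** Requiring [E] to vanish on a stable [U] makes induction possible without
    choosing bases of quotients: fixing the image of one vector [v] outside [U]
    costs [q ^ j] and enlarges [U] by at least two dimensions. *)
Lemma card_intertwiners_vanishing (k j : nat) (M U : 'M[F]_k) (N : 'M[F]_j) :
  (forall a, M - a%:M \in unitmx) -> stablemx U M ->
  (#|[set E : 'M[F]_(k, j) | (M *m E == E *m N) && (U *m E == 0%R)]|
     <= q ^ (j * (k - \rank U)./2))%N.
Proof.
move=> noeig; have [d] := ubnP (k - \rank U)%N; elim: d U => // d IHd U le_d sU.
have [fU|] := boolP (row_full U).
  apply: leq_trans (expq_gt0 F _).
  rewrite -(cards1 (0%R : 'M[F]_(k, j))); apply/subset_leq_card/fintype.subsetP => E.
  rewrite !inE => /andP[_ /eqP UE].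
  by rewrite -mxrank_eq0 -(eqmxMfull E fU) UE mxrank0.
rewrite -sub1mx => /row_subPn[i]; set v := row i _ => vU.
set T := [set E | _].
pose Tv := [set E in T | v *m E == 0%R].
(* W replaces the submodule generated by U and v: kernels of intertwiners are
   stable, so W is stable without any description of its elements. *)
pose W := (\bigcap_(E in Tv) kermx E)%MS.
have sW : stablemx W M.
  apply/sub_bigcapmxP=> E TvE; apply/sub_kermxP.
  have /sub_kermxP WE : (W <= kermx E)%MS by apply: bigcapmx_inf TvE (submx_refl _).
  move: TvE; rewrite !inE => /andP[/andP[/eqP ME _] _].
  by rewrite -mulmxA ME mulmxA WE mul0mx.
have UW : (U <= W)%MS.
  apply/sub_bigcapmxP=> E; rewrite !inE => /andP[/andP[_ /eqP UE] _].
  exact/sub_kermxP.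
have vW : (v <= W)%MS.
  by apply/sub_bigcapmxP=> E; rewrite !inE => /andP[_ /eqP vE]; apply/sub_kermxP.
have jump := stablemx_rank_jump noeig sU sW UW vW vU.
have leW := rank_leq_row W.
have {}IHd := IHd W _ sW; set TW := [set _ | _] in IHd.
have: (#|T| <= #|[set: 'rV[F]_j]| * #|TW|)%N.
  apply: (@card_le_translates _ _ _ _ _ (fun E => v *m E)) => [E _|E E' TE TE' vEE'].
    by rewrite inE.
  have TvE : E - E' \in Tv.
    move: TE TE'; rewrite !inE => /andP[/eqP ME /eqP UE] /andP[/eqP ME' /eqP UE'].
    by rewrite !mulmxBr mulmxBl ME ME' UE UE' vEE' !subrr !eqxx.
  rewrite inE; apply/andP; split.
    by move: TvE; rewrite !inE => /andP[/andP[]].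
  apply/eqP/sub_kermxP; exact: bigcapmx_inf TvE (submx_refl _).
move/leq_trans; apply; rewrite cardsT card_mx mul1n.
apply: (@leq_trans (q ^ j * q ^ (j * (k - \rank W)./2))).
  by rewrite leq_mul // IHd //; lia.
rewrite -expnD expq_leq // -mulnS leq_mul2l; lia.
Qed.

Lemma card_intertwiners (k j : nat) (M : 'M[F]_k) (N : 'M[F]_j) :
  (forall a, M - a%:M \in unitmx) ->
  (#|[set E : 'M[F]_(k, j) | M *m E == E *m N]| <= q ^ (j * k./2))%N.
Proof.
move=> noeig; have := @card_intertwiners_vanishing k j M 0 N noeig.
rewrite mxrank0 subn0 mul0mx sub0mx => /(_ isT); apply: leq_trans.
apply/subset_leq_card/fintype.subsetP=> E; rewrite !inE mul0mx eqxx andbT.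
by [].
Qed.

End Intertwiners.

(** * Square roots of a matrix *)
Section SquareRoots.
Variable F : finFieldType.
Local Notation q := #|F|.

Definition sqroots (k : nat) (D : 'M[F]_k) := [set Y | Y *m Y == D].

Definition max_sqroots (k : nat) := (\max_(D : 'M[F]_k) #|sqroots D|)%N.

Lemma card_sqroots_max (k : nat) (D : 'M[F]_k) : (#|sqroots D| <= max_sqroots k)%N.
Proof. exact: (leq_bigmax D). Qed.

Lemma conj_inj (k : nat) (P : 'M[F]_k) :
  P \in unitmx -> injective (fun Y => P *m Y *m invmx P).
Proof.
move=> uP Y Z /(congr1 (mulmx^~ P)); rewrite !mulmxKV // => /(congr1 (mulmx (invmx P))).
by rewrite !mulKmx.
Qed.

Lemma conj_mul (k : nat) (P Y Z : 'M[F]_k) : P \in unitmx ->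
  (P *m Y *m invmx P) *m (P *m Z *m invmx P) = P *m (Y *m Z) *m invmx P.
Proof. by move=> uP; rewrite !mulmxA mulmxKV. Qed.

Lemma conj_stable_block (w u : nat) (P Y : 'M[F]_(w + u)) Y1 :
  P \in unitmx -> usubmx P *m Y = Y1 *m usubmx P ->
  ulsubmx (P *m Y *m invmx P) = Y1 /\ ursubmx (P *m Y *m invmx P) = 0.
Proof.
by move=> uP PY; rewrite /ulsubmx /ursubmx (conj_stable uP PY) row_mxKl row_mxKr.
Qed.

Lemma card_scalar_sqroots (d : 'M[F]_1) : (#|sqroots d| <= 2)%N.
Proof.
have [->|[c]] := set_0Vmem (sqroots d); first by rewrite cards0.
rewrite inE => /eqP cd; apply: (@leq_trans #|[set c; - c]|); last first.
  by rewrite cards2; case: (_ != _).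
apply/subset_leq_card/fintype.subsetP=> x; rewrite !inE => /eqP xd.
have /eqP : x 0 0 ^+ 2 = c 0 0 ^+ 2.
  by move/matrixP: xd => /(_ 0 0); rewrite -cd !mxE !big_ord1.
rewrite eqf_sqr => /orP[]/eqP xc; apply/orP; [left|right]; apply/eqP/matrixP=> i j.
  by rewrite !ord1.
by rewrite !ord1 mxE.
Qed.

(** The line of [e] being stable, [Y] is block triangular: the scalar on the line
    is a square root of a scalar, the quotient block a square root of the
    quotient of [D], and the remaining column is arbitrary. *)
Lemma card_sqroots_line (u : nat) (D : 'M[F]_(1 + u)) (e : 'rV_(1 + u)) :
  e != 0 ->
  (#|[set Y in sqroots D | (e *m Y <= e)%MS]| <= 2 * q ^ u * max_sqroots u)%N.
Proof.
move=> e0; have fe : row_free e by rewrite -row_leq_rank rank_rV e0.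
have [C uP] := complete_row_free fe; set P := col_mx e C in uP.
pose Z Y := P *m Y *m invmx P.
pose B := finset.setX (finset.setX (sqroots (ulsubmx (Z D))) [set: 'M[F]_(u, 1)]) (sqroots (drsubmx (Z D))).
have blockZ Y : (e *m Y <= e)%MS -> Z Y = block_mx (ulsubmx (Z Y)) 0 (dlsubmx (Z Y)) (drsubmx (Z Y)).
  case/submxP=> c eY; have [|_ ur0] := @conj_stable_block 1 u P Y c uP.
    by rewrite col_mxKu.
  by rewrite -[LHS]submxK ur0.
apply: (@leq_trans #|B|).
  apply: (@card_le_inj _ _ _ _ (fun Y => (ulsubmx (Z Y), dlsubmx (Z Y), drsubmx (Z Y)))) => [Y|Y Y'].
    rewrite !inE /= => /andP[/eqP YD /blockZ zY].
    have: Z Y *m Z Y = Z D by rewrite conj_mul // YD.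
    rewrite zY mulmx_block => <-.
    by rewrite !(block_mxKul, block_mxKdr, block_mxKdl) !mul0mx mulmx0 !(addr0, add0r) !eqxx.
  rewrite !inE /= => /andP[_ /blockZ zY] /andP[_ /blockZ zY'] [ul dl dr].
  by apply: (conj_inj uP); rewrite -/(Z Y) -/(Z Y') zY zY' ul dl dr.
rewrite !cardsX cardsT card_mx muln1.
by rewrite leq_mul ?card_sqroots_max // leq_mul // card_scalar_sqroots.
Qed.

(** As [w Y = e Y^2 = a e], the plane spanned by [e] and [w] is stable and the
    action on it is known.  Comparing the lower left blocks of [Y^2 = D], one of
    the two columns of that block determines the other, which is why the factor
    is [q ^ u] and not [q ^ (2 * u)]. *)
Lemma card_sqroots_plane (u : nat) (D : 'M[F]_(1 + 1 + u)) (e w : 'rV_(1 + 1 + u)) a :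
  row_free (col_mx e w) -> e *m D = a *: e ->
  (#|[set Y in sqroots D | e *m Y == w]| <= q ^ u * max_sqroots u)%N.
Proof.
move=> fe eD.
have [C uP] := complete_row_free fe; set P := col_mx _ C in uP.
pose Z Y := P *m Y *m invmx P.
pose J : 'M[F]_(1 + 1) := block_mx 0 1 a%:M 0.
have blockZ Y : Y *m Y = D -> e *m Y = w -> Z Y = block_mx J 0 (dlsubmx (Z Y)) (drsubmx (Z Y)).
  move=> YD eY; have [|ul ur] := @conj_stable_block _ u P Y J uP; last first.
    by rewrite -[LHS]submxK ul ur.
  rewrite col_mxKu /J mul_col_mx mul_block_col !mul0mx mul1mx add0r addr0 mul_scalar_mx -eD.
  by rewrite eY -eY -mulmxA YD.
have blockM Y : Y *m Y = D -> e *m Y = w ->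
    Z D = block_mx (J *m J) 0 (dlsubmx (Z Y) *m J + drsubmx (Z Y) *m dlsubmx (Z Y)) (drsubmx (Z Y) *m drsubmx (Z Y)).
  move=> YD eY; have: Z Y *m Z Y = Z D by rewrite conj_mul // YD.
  rewrite {1 2}(blockZ Y YD eY) mulmx_block => <-.
  by rewrite !mul0mx !mulmx0 !(addr0, add0r).
pose B := finset.setX [set: 'M[F]_(u, 1)] (sqroots (drsubmx (Z D))).
apply: (@leq_trans #|B|).
  apply: (@card_le_inj _ _ _ _ (fun Y => (rsubmx (dlsubmx (Z Y)), drsubmx (Z Y)))) => [Y|Y Y'].
    by rewrite !inE /= => /andP[/eqP YD /eqP /(blockM _ YD) ->]; rewrite block_mxKdr.
  rewrite !inE /= => /andP[/eqP YD /eqP eY] /andP[/eqP YD' /eqP eY'] [r dr].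
  apply: (conj_inj uP); rewrite -/(Z Y) -/(Z Y') (blockZ Y) // (blockZ Y') // dr.
  congr (block_mx _ _ _ _); rewrite -[LHS]hsubmxK -[RHS]hsubmxK r; congr row_mx.
  have := congr1 dlsubmx (etrans (esym (blockM Y YD eY)) (blockM Y' YD' eY')).
  rewrite !block_mxKdl dr -[X in X *m J + _]hsubmxK -[X in _ + _ *m X]hsubmxK.
  rewrite -[X in _ = X *m J + _]hsubmxK -[X in _ = _ + _ *m X]hsubmxK r.
  rewrite /J !mul_row_block !mul_mx_row !add_row_mx !mulmx1 !mulmx0 !addr0 => /eq_row_mx[_].
  by move/addIr.
by rewrite !cardsX cardsT card_mx muln1 leq_mul // card_sqroots_max.
Qed.

(** Without eigenvectors, [Y] commutes with [D = Y^2] and the intertwiner bound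
    applies.  With an eigenvector [e], either [Y] preserves its line or the
    [q ^ u.+2] possible images of [e] each give a stable plane. *)
Lemma max_sqroots_step (u : nat) :
  (max_sqroots u.+2 <= maxn (q ^ (u.+2 * (u.+2)./2))
     (2 * q ^ u.+1 * max_sqroots u.+1 + q ^ u.+2 * (q ^ u * max_sqroots u)))%N.
Proof.
apply/bigmax_leqP => D _; rewrite leq_max.
have [/forallP noeig|/forallPn[a]] := boolP [forall a, D - a%:M \in unitmx].
  apply/orP; left; apply: leq_trans (card_intertwiners D noeig).
  apply/subset_leq_card/fintype.subsetP=> Y; rewrite !inE => /eqP <-.
  by rewrite mulmxA.
rewrite -row_free_unit -kermx_eq0 => /rowV0Pn[e /sub_kermxP].
rewrite mulmxBr mul_mx_scalar => /subr0_eq eD e0; apply/orP; right.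
rewrite -(cardsID [set Y | (e *m Y <= e)%MS]) leq_add //.
  apply: leq_trans (card_sqroots_line (D : 'M[F]_(1 + u.+1)) (e0 : (e : 'rV_(1 + u.+1)) != 0)).
  by apply/subset_leq_card/fintype.subsetP=> Y; rewrite !inE.
have -> : (q ^ u.+2 = #|[set: 'rV[F]_u.+2]|)%N by rewrite cardsT card_mx mul1n.
apply: (@card_le_fibers _ _ _ _ (fun Y => e *m Y)) => [Y|w _]; first by rewrite inE.
have [->|[Y0]] := set_0Vmem [set x in sqroots D :\: [set Y | (e *m Y <= e)%MS] | e *m x == w].
  by rewrite cards0.
rewrite !inE => /andP[/andP[nle _] /eqP eY0].
apply: leq_trans (@card_sqroots_plane u D e w a _ eD).
  by apply/subset_leq_card/fintype.subsetP=> Y; rewrite !inE => /andP[/andP[_ ->] ->].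
rewrite -row_leq_rank -addsmxE.
have : (e < e + w)%MS by rewrite /ltmx addsmxSl addsmx_sub submx_refl /= -eY0.
by rewrite ltmxErank => /andP[_]; rewrite rank_rV e0.
Qed.

Lemma max_sqroots0 : max_sqroots 0 = 1%N.
Proof.
apply/eqP; rewrite eqn_leq; apply/andP; split.
  apply/bigmax_leqP => D _; apply: leq_trans (max_card _) _.
  by rewrite card_mx.
apply: leq_trans (card_sqroots_max 0); apply/card_gt0P; exists 0.
by rewrite inE thinmx0.
Qed.

Lemma max_sqroots1 : (max_sqroots 1 <= 2)%N.
Proof. by apply/bigmax_leqP => D _; apply: card_scalar_sqroots. Qed.

(** With [Z = 4^k q^(k^2)] the two terms of the recursion are at most
    [sqrt (Z / q)] and [sqrt (Z / 16)].  Their sum is below [sqrt Z] as soon as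
    [q >= 3], because [1 / sqrt 3 + 1 / 4 < 1]. *)
Lemma max_sqroots_bound (k : nat) :
  (2 < q)%N -> (max_sqroots k ^ 2 <= 4 ^ k * q ^ (k * k))%N.
Proof.
move=> q3; have [] // : (max_sqroots k ^ 2 <= 4 ^ k * q ^ (k * k))%N /\
   (max_sqroots k.+1 ^ 2 <= 4 ^ k.+1 * q ^ (k.+1 * k.+1))%N.
elim: k => [|k [IH0 IH1]].
  rewrite max_sqroots0; split=> //; apply: (@leq_trans 4).
    by rewrite (@leq_exp2r _ 2 2) // max_sqroots1.
  by rewrite leq_pmulr // expq_gt0.
split=> //; apply: leq_trans (_ : (maxn _ _) ^ 2 <= _)%N.
  by rewrite leq_exp2r //; apply: max_sqroots_step.
rewrite /maxn; case: ifP => _; last first.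
  rewrite -expnM -[X in (X <= _)%N]mul1n leq_mul ?expn_gt0 // expq_leq // -mulnA leq_mul2l.
  lia.
set x := max_sqroots k.+1 in IH1 *; set y := max_sqroots k in IH0 *.
set X := (2 * _ * x)%N; set Y := (_ ^ k.+2 * (_ * y))%N; set Z := (4 ^ _ * _)%N.
have HX : (3 * X ^ 2 <= Z)%N.
  have -> : (X ^ 2 = 4 * q ^ (k.+1 * 2) * x ^ 2)%N by rewrite /X !expnMn -expnM.
  apply: (@leq_trans (q * (4 * q ^ (k.+1 * 2) * (4 ^ k.+1 * q ^ (k.+1 * k.+1))))).
    by rewrite leq_mul // leq_mul.
  have -> : (q * (4 * q ^ (k.+1 * 2) * (4 ^ k.+1 * q ^ (k.+1 * k.+1))) = 4 ^ k.+2 * (q ^ 1 * q ^ (k.+1 * 2) * q ^ (k.+1 * k.+1)))%N.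
    rewrite expn1 (expnS 4 k.+1); move: (4 ^ k.+1)%N (q ^ _)%N (q ^ _)%N => ? ? ?; lia.
  rewrite -!expnD leq_mul // expq_leq //; lia.
have HY : (16 * Y ^ 2 <= Z)%N.
  have -> : (Y ^ 2 = q ^ (k.+2 * 2) * (q ^ (k * 2) * y ^ 2))%N.
    by rewrite /Y (expnMn (q ^ k.+2)) (expnMn (q ^ k)) (expnM _ k.+2) (expnM _ k).
  apply: (@leq_trans (16 * (q ^ (k.+2 * 2) * (q ^ (k * 2) * (4 ^ k * q ^ (k * k)))))).
    by rewrite !leq_mul2l IH0 !orbT.
  have -> : (16 * (q ^ (k.+2 * 2) * (q ^ (k * 2) * (4 ^ k * q ^ (k * k)))) = 4 ^ k.+2 * (q ^ (k.+2 * 2) * q ^ (k * 2) * q ^ (k * k)))%N.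
    rewrite !(expnS 4); move: (4 ^ k)%N (q ^ _)%N (q ^ _)%N (q ^ _)%N => ? ? ? ?; lia.
  rewrite -!expnD leq_mul // expq_leq //; lia.
move: HX HY; rewrite -!mulnn; clearbody X Y Z; nia.
Qed.

End SquareRoots.

(** * Matrices anticommuting with an invertible matrix *)
Section Anticommutants.
Variable F : finFieldType.
Local Notation q := #|F|.

Definition anticomm (k : nat) (M : 'M[F]_k) := [set E | E *m M == - (M *m E)].

Lemma anticommB (k : nat) (M E E' : 'M[F]_k) :
  E \in anticomm M -> E' \in anticomm M -> E - E' \in anticomm M.
Proof.
by rewrite !inE mulmxBl mulmxBr => /eqP-> /eqP->; rewrite opprB opprK addrC.
Qed.

Lemma card_anticomm_conj (k : nat) (P M : 'M[F]_k) : P \in unitmx ->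
  (#|anticomm M| <= #|anticomm (P *m M *m invmx P)|)%N.
Proof.
move=> uP; apply: (@card_le_inj _ _ _ _ (fun E => P *m E *m invmx P)) => [E|E E' _ _].
  by rewrite !inE !conj_mul // => /eqP->; rewrite mulmxN mulNmx.
exact: conj_inj.
Qed.

(** The off-diagonal blocks of [E] lie, successively, in the left and in the
    right eigenspace of [N] for [- a], and the lower right block anticommutes
    with [N]; since [a + a] is nonzero, the corner is forced. *)
Lemma card_anticomm_block (u : nat) (a : F) (m : 'M[F]_(u, 1)) (N : 'M[F]_u) :
  a + a != 0 ->
  (#|anticomm (block_mx a%:M 0 m N)|
     <= q ^ (u - \rank (N + a%:M)%R) * (#|anticomm N| * q ^ (u - \rank (N + a%:M)%R)))%N.
Proof.
move=> a2; set M := block_mx _ _ _ _; have aP E : E \in anticomm M ->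
  [/\ ursubmx E *m N = - (a *: ursubmx E),
      ursubmx E = 0 -> ulsubmx E = 0,
      drsubmx E *m N = - (m *m ursubmx E + N *m drsubmx E) &
      a *: dlsubmx E + drsubmx E *m m = - (m *m ulsubmx E + N *m dlsubmx E)].
  rewrite inE -[E]submxK /M !mulmx_block opp_block_mx !(block_mxKul, block_mxKur, block_mxKdl, block_mxKdr).
  rewrite !mulmx0 !mul0mx !mul_scalar_mx !mul_mx_scalar !(add0r, addr0).
  move/eqP/eq_block_mx => [ul -> -> ->]; split=> // ur0; move: ul.
  rewrite ur0 mul0mx addr0 => /eqP; rewrite -addr_eq0 -scalerDl scaler_eq0 (negPf a2).
  by move/eqP.
have urB (E E' : 'M[F]_(1 + u)) : ursubmx (E - E') = ursubmx E - ursubmx E'.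
  by apply/matrixP=> i j; rewrite !mxE.
have drB (E E' : 'M[F]_(1 + u)) : drsubmx (E - E') = drsubmx E - drsubmx E'.
  by apply/matrixP=> i j; rewrite !mxE.
pose K1 := [set E in anticomm M | ursubmx E == 0].
have K1P E : reflect (E \in anticomm M /\ ursubmx E = 0) (E \in K1).
  by rewrite [X in reflect _ X]inE; apply: (iffP andP) => -[? /eqP].
pose K2 := [set E in K1 | drsubmx E == 0].
have K2P E : reflect (E \in K1 /\ drsubmx E = 0) (E \in K2).
  by rewrite [X in reflect _ X]inE; apply: (iffP andP) => -[? /eqP].
apply: (@leq_trans (#|[set X : 'M[F]_(1, u) | X *m (N + a%:M) == 0%R]| * #|K1|)).
  apply: (@card_le_translates _ _ _ _ _ (@ursubmx _ 1 u 1 u)) => [E /aP[ur _ _ _]|E E' aE aE' urE].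
    by rewrite inE mulmxDr mul_mx_scalar ur addNr.
  by apply/K1P; split; [apply: anticommB|rewrite urB urE subrr].
apply: leq_mul; first by rewrite -[X in (_ <= q ^ X)%N]mul1n card_left_kernel.
apply: (@leq_trans (#|anticomm N| * #|K2|)).
  apply: (@card_le_translates 'M[F]_(1 + u) 'M[F]_u K1 K2 (anticomm N) (@drsubmx _ 1 u 1 u)).
    by move=> E /K1P[/aP[_ _ dr _] ur]; rewrite inE dr ur mulmx0 add0r.
  move=> E E' /K1P[aE ur] /K1P[aE' ur'] drE; apply/K2P; split.
    by apply/K1P; rewrite anticommB // urB ur ur' subrr.
  by rewrite drB drE subrr.
apply: leq_mul => //; rewrite -[X in (_ <= q ^ X)%N]mul1n; apply: leq_trans (card_right_kernel _ _).
apply: (@card_le_inj _ _ _ _ (@dlsubmx _ 1 u 1 u)).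
  move=> E /K2P[/K1P[/aP[_ ul _ dl] ur] dr].
  move: dl; rewrite dr mul0mx addr0 (ul ur) mulmx0 add0r => dl.
  by rewrite inE mulmxDl mul_scalar_mx dl addrN.
move=> E E' /K2P[/K1P[/aP[_ ul _ _] ur] dr] /K2P[/K1P[/aP[_ ul' _ _] ur'] dr'] dl.
by rewrite -[E]submxK -[E']submxK ur ur' dr dr' dl ul // ul'.
Qed.

(** Of the two eigenvalues [a] and [- a] one removes the vector from the larger
    eigenspace, so the opposite eigenspace has dimension at most half of the
    total.  The rounding in [(k * k)./2] is essential: when [k] is even the two
    off-diagonal blocks may contribute [q ^ k], half a unit too much for the
    exponent [k^2 / 2] but not for the floor, as [(k - 1)^2] is then odd. *)
Lemma card_anticomm_unit (k : nat) (M : 'M[F]_k) :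
  (2%:R != 0 :> F) -> M \in unitmx -> (#|anticomm M| <= q ^ (k * k)./2)%N.
Proof.
move=> F2; elim: k M => [|u IHu] M uM.
  by apply: leq_trans (max_card _) _; rewrite card_mx.
have [/forallP noeig|/forallPn[a Ma]] := boolP [forall a, M - a%:M \in unitmx].
  apply: (@leq_trans (q ^ (u.+1 * u.+1./2))); last first.
    by apply: expq_leq; rewrite geq_half_double -muln2 -mulnA leq_mul2l; lia.
  apply: leq_trans (card_intertwiners (- M) noeig).
  apply/subset_leq_card/fintype.subsetP=> E; rewrite !inE => /eqP EM.
  by rewrite mulmxN EM opprK.
have a0 : a != 0 by apply: contraNneq Ma => ->; rewrite raddf0 subr0.
have [b [b0 sMb leb]] : exists b : F, [/\ b != 0, (\rank (M - b%:M)%R < u.+1)%N &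
    (\rank (M - b%:M)%R <= \rank (M + b%:M)%R)%N].
  have ra : (\rank (M - a%:M)%R < u.+1)%N.
    by rewrite ltn_neqAle rank_leq_row andbT -/(row_free _) row_free_unit.
  have [le|lt] := leqP (\rank (M - a%:M)%R) (\rank (M + a%:M)%R); first by exists a.
  exists (- a); rewrite oppr_eq0 raddfN /= opprK; split=> //; last exact: ltnW.
  exact: leq_trans lt (ltnW ra).
have b2 : b + b != 0 by rewrite -mulr2n -mulr_natr mulf_neq0.
have leMb : (u.+1 <= 2 * \rank (M + b%:M)%R)%N.
  have rB : \rank ((M + b%:M) - (M - b%:M))%R = u.+1.
    rewrite opprB addrCA addrAC addrN add0r -raddfD; apply: mxrank_unit.
    by rewrite unitmxE det_scalar unitrX // unitfE.
  have := mxrank_add (M + b%:M) (- (M - b%:M)); rewrite rB mxrank_opp; lia.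
have: ~~ row_free (M - b%:M) by rewrite /row_free neq_ltn sMb.
rewrite -kermx_eq0 => /rowV0Pn[e /sub_kermxP].
rewrite mulmxBr mul_mx_scalar => /subr0_eq eM e0.
have fe : @row_free F 1 (1 + u) e by rewrite -row_leq_rank rank_rV e0.
have [C uP] := complete_row_free fe; set P := col_mx _ C in uP.
have [|ul ur] := @conj_stable_block _ 1 u P M b%:M uP.
  by rewrite col_mxKu mul_scalar_mx.
set Z := _ *m _ in ul ur.
have eZ : Z = block_mx b%:M 0 (dlsubmx Z) (drsubmx Z) by rewrite -[LHS]submxK ul ur.
set m := dlsubmx Z in eZ; set N := drsubmx Z in eZ.
have uN : N \in unitmx.
  have: Z \in unitmx by rewrite !unitmx_mul uP uM unitmx_inv uP.
  by rewrite eZ unitmxE det_lblock unitrM -!unitmxE => /andP[].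
(* Passing to the quotient by the line of e does not enlarge the eigenspace
   for - b, because e belongs to the eigenvalue b, which differs from - b. *)
have rN : (\rank (M + b%:M)%R <= 1 + \rank (N + b%:M)%R)%N.
  have -> : \rank (M + b%:M)%R = \rank (Z + b%:M)%R.
    have -> : Z + b%:M = P *m (M + b%:M) *m invmx P.
      by rewrite mulmxDr mulmxDl mul_mx_scalar -scalemxAl mulmxV // scalemx1.
    by rewrite mxrankMfree ?row_free_unit ?unitmx_inv // eqmxMfull // row_full_unit.
  rewrite eZ (scalar_mx_block 1 u) add_block_mx !addr0 -raddfD /=.
  have -> : block_mx (b + b)%:M 0 m (N + b%:M) =
      col_mx 1 ((b + b)^-1 *: m) *m row_mx (b + b)%:M 0 + col_mx 0 1 *m row_mx 0 (N + b%:M).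
    rewrite !mul_col_mx !mul0mx !mul1mx add_col_mx mul_mx_row add_row_mx !(addr0, add0r).
    by rewrite mulmx0 mul_mx_scalar scalerA mulfV // scale1r add0r.
  apply: leq_trans (mxrank_add _ _) (leq_add _ _).
    by apply: leq_trans (mxrankM_maxr _ _) (rank_leq_row _).
  by apply: leq_trans (mxrankM_maxr _ _) _; rewrite rank_row_0mx.
apply: leq_trans (card_anticomm_conj M uP) _; rewrite -/Z eZ.
apply: leq_trans (card_anticomm_block _ _ b2) _.
apply: (@leq_trans (q ^ (u - \rank (N + b%:M)%R) * (q ^ (u * u)./2 * q ^ (u - \rank (N + b%:M)%R)))).
  by rewrite !leq_mul ?IHu.
rewrite -!expnD; apply: expq_leq; move: leMb rN.
move: (\rank _) (\rank _) => x y {IHu M uM a Ma a0 b b0 sMb leb b2 e eM e0 fe C P uP Z ul ur m N eZ uN}.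
have [t] : exists t, (u = 2 * t \/ u = 2 * t + 1)%N by exists u./2; lia.
by case=> ->; nia.
Qed.
End Anticommutants.

(** * Reduction to the image *)
Section ImageReduction.
Variable F : finFieldType.
Local Notation q := #|F|.

Definition selfsol (n : nat) (C : 'M[F]_n) :=
  [set X : 'M[F]_n | (X \in unitmx) && (X *m C *m X == C)].

Lemma card_selfsol_conj (n : nat) (P C : 'M[F]_n) : P \in unitmx ->
  (#|selfsol C| <= #|selfsol (P *m C *m invmx P)|)%N.
Proof.
move=> uP; apply: (@card_le_inj _ _ _ _ (fun X => P *m X *m invmx P)) => [X|X Y _ _].
  rewrite !inE !conj_mul // => /andP[uX /eqP->].
  by rewrite eqxx !unitmx_mul uP uX unitmx_inv uP.
exact: conj_inj.
Qed.

Lemma mxrank_conj (n : nat) (P M : 'M[F]_n) : P \in unitmx ->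
  \rank (P *m M *m invmx P) = \rank M.
Proof.
by move=> uP; rewrite mxrankMfree ?row_free_unit ?unitmx_inv // eqmxMfull // row_full_unit.
Qed.

Lemma conj_exp (n m : nat) (P M : 'M[F]_n) : P \in unitmx ->
  (P *m M *m invmx P) ^+ m = P *m M ^+ m *m invmx P.
Proof.
move=> uP; elim: m => [|m IHm]; first by rewrite !expr0 mulmx1 mulmxV.
by rewrite exprS IHm -[LHS]/(_ *m _) conj_mul // -[M *m _]/(M * _) -exprS.
Qed.

(** In a basis that starts with a basis of the row space, all rows of [C] are
    supported on the first [r] coordinates. *)
Lemma image_block_form (r u : nat) (C : 'M[F]_(r + u)) : \rank C = r ->
  exists (P : 'M[F]_(r + u)) (G : 'M[F]_(r + u, r)),
    [/\ P \in unitmx, row_full G & P *m C *m invmx P = row_mx G 0].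
Proof.
move=> rC; have [B fB eB] := eq_rank_basis rC.
have [D uP] := complete_row_free fB; set P := col_mx B D in uP *.
have /submxP[G PC] : (P *m C <= B)%MS by rewrite eB submxMl.
have eC : P *m C *m invmx P = row_mx G 0.
  rewrite PC -mulmxA; have -> : B *m invmx P = usubmx (P *m invmx P).
    by rewrite -mul_usub_mx col_mxKu.
  rewrite mulmxV // (scalar_mx_block r u) /block_mx col_mxKu.
  by rewrite mul_mx_row mulmx1 mulmx0.
exists P, G; split=> //; rewrite /row_full.
by rewrite -[X in _ == X]rC -(mxrank_conj C uP) eC rank_row_mx0.
Qed.

(** Once the action on the image is fixed, the upper rows of [X] are known and
    the lower [u] rows satisfy linear equations whose homogeneous part is
    multiplication by [G], of rank [r]: this leaves [u] free parameters per row. *)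
Lemma card_lower_block (r u : nat) (G : 'M[F]_(r + u, r)) (T : {set 'M[F]_(r + u)})
    (B : {set 'M[F]_r}) :
  row_full G ->
  (forall X, X \in T -> ursubmx X = 0 /\ ulsubmx X \in B) ->
  (forall X Y, X \in T -> Y \in T -> ulsubmx X = ulsubmx Y -> X *m G = Y *m G) ->
  (#|T| <= q ^ (u * u) * #|B|)%N.
Proof.
move=> /eqP fG TB TG; rewrite mulnC.
pose K := [set D : 'M[F]_(r + u) | (usubmx D == 0) && (dsubmx D *m G == 0)].
apply: (@leq_trans (#|B| * #|K|)).
  apply: (@card_le_translates 'M[F]_(r + u) 'M[F]_r T K B (@ulsubmx _ r u r u)) => [X /TB[]//|X Y TX TY ulXY].
  have subXY : X *m G - Y *m G = 0 by rewrite (TG X Y) // subrr.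
  rewrite inE mul_dsub_mx mulmxBl subXY linear0 eqxx andbT.
  have -> : usubmx (X - Y) = usubmx X - usubmx Y by apply/matrixP=> i j; rewrite !mxE.
  rewrite -[usubmx X]hsubmxK -[usubmx Y]hsubmxK -!/(ulsubmx _) -!/(ursubmx _) ulXY.
  by have [-> _] := TB X TX; have [-> _] := TB Y TY; rewrite subrr.
apply: leq_mul => //; have := card_left_kernel u G; rewrite fG addKn.
apply: leq_trans; apply: (@card_le_inj _ _ _ _ (@dsubmx _ r u (r + u))) => [X|X Y].
  by rewrite !inE => /andP[].
rewrite !inE => /andP[/eqP uX _] /andP[/eqP uY _] dXY.
by rewrite -[X]vsubmxK -[Y]vsubmxK uX uY dXY.
Qed.

Lemma row_full_mul0 (m n k : nat) (G : 'M[F]_(m, n)) (X : 'M[F]_(n, k)) :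
  row_full G -> G *m X = 0 -> X = 0.
Proof.
by move=> fG GX; apply/eqP; rewrite -mxrank_eq0 -(eqmxMfull X fG) GX mxrank0.
Qed.

Lemma mul_row_mx0 (r u : nat) (G : 'M[F]_(r + u, r)) (X : 'M[F]_(r + u)) :
  row_mx G 0 *m X = row_mx (G *m ulsubmx X) (G *m ursubmx X).
Proof.
by rewrite -[X in _ *m X]submxK mul_row_block !mul0mx !addr0.
Qed.

Lemma usub_mul_lower (r u : nat) (G : 'M[F]_(r + u, r)) (X : 'M[F]_(r + u)) :
  ursubmx X = 0 -> usubmx (X *m G) = ulsubmx X *m usubmx G.
Proof.
move=> ur0; rewrite -mul_usub_mx -[in LHS](vsubmxK G) -[usubmx X]hsubmxK.
by rewrite -/(ursubmx X) ur0 mul_row_col mul0mx addr0.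
Qed.

(** From [C X = X^-1 C] the row space of [C] is stable under [X], and the upper
    left block solves the same equation for the restriction [usubmx G] of [C]. *)
Lemma card_selfsol_image (r u : nat) (G : 'M[F]_(r + u, r)) : row_full G ->
  (#|selfsol (row_mx G 0)| <= q ^ (u * u) * #|selfsol (usubmx G)|)%N.
Proof.
move=> fG; set C := row_mx G 0.
have solP (X : 'M[F]_(r + u)) : X \in selfsol C ->
    [/\ ursubmx X = 0, ulsubmx X \in unitmx & X *m G *m ulsubmx X = G].
  rewrite inE => /andP[uX /eqP XC].
  have : invmx X *m C = C *m X by rewrite -{1}XC -mulmxA mulKmx.
  rewrite mul_row_mx0 mul_mx_row mulmx0 => /eq_row_mx[GX /esym/(row_full_mul0 fG) ur0].
  split=> //; last by rewrite -mulmxA -GX mulKVmx.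
  have : block_mx (ulsubmx X) 0 (dlsubmx X) (drsubmx X) \in unitmx by rewrite -ur0 submxK.
  by rewrite unitmxE det_lblock unitrM -unitmxE => /andP[].
apply: (card_lower_block fG) => [X|X Y] /solP[ur0 uX XG].
  by split=> //; rewrite inE uX -(usub_mul_lower _ ur0) mul_usub_mx XG eqxx.
move=> /solP[_ uY YG] ulXY; apply: (can_inj (mulmxK uX)).
by rewrite XG ulXY YG.
Qed.

Lemma card_anticomm_image (r u : nat) (G : 'M[F]_(r + u, r)) : row_full G ->
  (#|anticomm (row_mx G 0)| <= q ^ (u * u) * #|anticomm (usubmx G)|)%N.
Proof.
move=> fG; have solP E : E \in anticomm (row_mx G 0) ->
    ursubmx E = 0 /\ E *m G = - (G *m ulsubmx E).
  rewrite inE mul_row_mx0 mul_mx_row mulmx0 opp_row_mx => /eqP/eq_row_mx[-> /esym/eqP].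
  by rewrite oppr_eq0 => /eqP/(row_full_mul0 fG).
apply: (card_lower_block fG) => [E|E E'] /solP[ur0 EG].
  by split=> //; rewrite inE -(usub_mul_lower _ ur0) EG raddfN /= mul_usub_mx.
by move=> /solP[_ EG'] ul; rewrite EG EG' ul.
Qed.

Lemma ulsubmx_row0 (r u : nat) (K : 'M[F]_(r + u, r)) :
  ulsubmx (row_mx K (0 : 'M[F]_(r + u, u))) = usubmx K.
Proof. by apply/matrixP=> i j; rewrite !mxE (unsplitK (inl _)). Qed.

Lemma ursubmx_row0 (r u : nat) (K : 'M[F]_(r + u, r)) :
  ursubmx (row_mx K (0 : 'M[F]_(r + u, u))) = 0.
Proof. by apply/matrixP=> i j; rewrite !mxE (unsplitK (inr _)) !mxE. Qed.

Lemma image_exp (r u m : nat) (G : 'M[F]_(r + u, r)) :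
  row_mx G 0 ^+ m.+1 = row_mx (G *m usubmx G ^+ m) 0.
Proof.
elim: m => [|m IHm]; first by rewrite expr0 mulmx1.
rewrite exprS IHm -[LHS]/(_ *m _) mul_row_mx0.
by rewrite ulsubmx_row0 ursubmx_row0 -mul_usub_mx mulmx0 -[usubmx G *m _]/(_ * _) -exprS.
Qed.

Lemma image_reduction (r u : nat) (C : 'M[F]_(r + u)) : \rank C = r ->
  exists C1 : 'M[F]_r,
    [/\ (r <= \rank C1 + u)%N, forall m, \rank (C ^+ m.+1) = \rank (C1 ^+ m),
        (#|selfsol C| <= q ^ (u * u) * #|selfsol C1|)%N &
        (#|anticomm C| <= q ^ (u * u) * #|anticomm C1|)%N].
Proof.
move=> rC; have [P [G [uP fG eC]]] := image_block_form rC.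
exists (usubmx G); split=> [|m||].
- rewrite -{1}(eqP fG) -[in X in (X <= _)%N](vsubmxK G) -addsmxE.
  by apply: leq_trans (mxrank_adds_leqif _ _) _; rewrite leq_add2l rank_leq_row.
- by rewrite -(mxrank_conj _ uP) -conj_exp // eC image_exp rank_row_mx0 eqmxMfull.
- by apply: leq_trans (card_selfsol_conj C uP) _; rewrite eC card_selfsol_image.
- by apply: leq_trans (card_anticomm_conj C uP) _; rewrite eC card_anticomm_image.
Qed.

(** The stable rank, in the form in which it passes to restrictions. *)
Definition ultimate_rank (n : nat) (C : 'M[F]_n) (s : nat) :=
  exists N, forall m, (N <= m)%N -> \rank (C ^+ m) = s.

Lemma ultimate_rank_unit (n s : nat) (C : 'M[F]_n) :
  C \in unitmx -> ultimate_rank C s -> s = n.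
Proof.
move=> uC [N /(_ N (leqnn N)) <-]; apply: mxrank_unit.
by elim: N => [|N IHN]; rewrite ?unitmx1 // exprS -[_ * _]/(_ *m _) unitmx_mul uC.
Qed.

Lemma ultimate_rank_le (n s : nat) (C : 'M[F]_n) :
  ultimate_rank C s -> (s <= \rank C)%N.
Proof.
move=> [N /(_ N.+1 (leqnSn N)) <-]; rewrite exprS -[_ * _]/(_ *m _).
exact: mxrankM_maxl.
Qed.

Lemma ultimate_rank_image (n r s : nat) (C : 'M[F]_n) (C1 : 'M[F]_r) :
  (forall m, \rank (C ^+ m.+1) = \rank (C1 ^+ m)) ->
  ultimate_rank C s -> ultimate_rank C1 s.
Proof. by move=> CC1 [N CN]; exists N => m Nm; rewrite -CC1 CN // ltnW. Qed.

(** Shared by the two counting problems.  With [u = n - r] and [r1] the rank of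
    the restriction, [(r - r1)(r - s) + u^2 <= u (n - s)] because [r - r1 <= u],
    which closes the induction for the first bound; the second comes from the
    first one applied to the restriction, because [r - r1 <= r - s]. *)
Lemma image_induction (b : nat) (f : forall n, 'M[F]_n -> nat) :
  (forall n (C : 'M[F]_n), C \in unitmx -> (f n C ^ 2 <= b ^ n * q ^ (n * n))%N) ->
  (forall r u (C : 'M[F]_(r + u)), \rank C = r ->
    exists C1 : 'M[F]_r,
    [/\ (r <= \rank C1 + u)%N, forall m, \rank (C ^+ m.+1) = \rank (C1 ^+ m) &
        (f _ C <= q ^ (u * u) * f _ C1)%N]) ->
  forall n s (C : 'M[F]_n), ultimate_rank C s ->
    (f n C ^ 2 <= b ^ s * q ^ (2 * ((n - \rank C) * (n - s)) + s * s))%N /\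
    (f n C ^ 2 <= b ^ s * q ^ (2 * ((n - \rank C) ^ 2 + (\rank C - s) ^ 2) + s * s))%N.
Proof.
move=> base step n; have [N] := ubnP n; elim: N n => // N IH n le_n s C Cs.
have [uC|nuC] := boolP (C \in unitmx).
  have sn := ultimate_rank_unit uC Cs; rewrite sn mxrank_unit // subnn !mul0n.
  by split; apply: base.
have ltr : (\rank C < n)%N.
  by rewrite ltn_neqAle rank_leq_row andbT -/(row_free _) row_free_unit.
have [r [u [rC nE]]] : exists r u, \rank C = r /\ n = (r + u)%N.
  by exists (\rank C), (n - \rank C)%N; split=> //; lia.
subst n; have [C1 [rC1 CC1 fC]] := step _ _ _ rC.
have C1s := ultimate_rank_image CC1 Cs.
have [] := IH r _ s C1 C1s; first by lia.
move=> IH1 _; have le_s := ultimate_rank_le C1s; have le_r := rank_leq_row C1.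
have bound : (f _ C ^ 2 <= b ^ s * q ^ (2 * (u * u) + (2 * ((r - \rank C1) * (r - s)) + s * s)))%N.
  rewrite expnD mulnCA (mulnC 2) expnM.
  apply: (@leq_trans ((q ^ (u * u) * f _ C1) ^ 2)); first by rewrite leq_exp2r.
  by rewrite (expnMn (q ^ (u * u))) leq_mul2l IH1 orbT.
rewrite rC; split; apply: leq_trans bound _; rewrite leq_mul2l expq_leq ?orbT //.
  have -> : (r + u - r = u)%N by lia.
  have -> : (r + u - s = u + (r - s))%N by lia.
  rewrite addnA leq_add2r -mulnDr leq_mul2l /= mulnDr leq_add2l leq_mul2r; lia.
have -> : (r + u - r = u)%N by lia.
rewrite addnA leq_add2r -mulnDr leq_mul2l /= -!mulnn leq_add2l leq_mul2r; lia.
Qed.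

Lemma selfsol_bound (n s : nat) (C : 'M[F]_n) : (2 < q)%N -> ultimate_rank C s ->
    (#|selfsol C| ^ 2 <= 4 ^ s * q ^ (2 * ((n - \rank C) * (n - s)) + s * s))%N /\
    (#|selfsol C| ^ 2 <= 4 ^ s * q ^ (2 * ((n - \rank C) ^ 2 + (\rank C - s) ^ 2) + s * s))%N.
Proof.
move=> q3; apply: (@image_induction 4 (fun n C => #|selfsol C|)).
  move=> {}n {}C uC; apply: leq_trans (max_sqroots_bound n q3).
  rewrite leq_exp2r //; apply: leq_trans (card_sqroots_max (C *m C)).
  apply: (@card_le_inj _ _ _ _ (mulmx C)) => [X|X Y _ _]; last exact: (can_inj (mulKmx uC)).
  by rewrite !inE => /andP[_ /eqP XC]; rewrite -mulmxA [X *m _]mulmxA XC.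
by move=> r u {}C /image_reduction[C1 [? ? ? _]]; exists C1.
Qed.

Lemma anticomm_bound (n s : nat) (C : 'M[F]_n) : 2%:R != 0 :> F -> ultimate_rank C s ->
  (#|anticomm C| ^ 2 <= q ^ (2 * ((n - \rank C) * (n - s)) + s * s))%N.
Proof.
move=> F2 Cs.
have [||+ _] := @image_induction 1 (fun n C => #|anticomm C|) _ _ n s C Cs.
- move=> {Cs}n {}C uC; rewrite exp1n mul1n.
  apply: (@leq_trans ((q ^ (n * n)./2) ^ 2)).
    by rewrite leq_exp2r // card_anticomm_unit.
  by rewrite -expnM expq_leq //; lia.
- by move=> r u {Cs}C /image_reduction[C1 [? ? _ ?]]; exists C1.
by rewrite exp1n mul1n.
Qed.
End ImageReduction.

(** * Lifting from modulus p ^ l to p ^ l.+1 *)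
Section Lifting.

(** Changes of modulus go through integer representatives, which makes the
    different residue rings comparable. *)
Definition zlift (q m n : nat) (X : 'M['Z_q]_(m, n)) : 'M[int]_(m, n) :=
  map_mx (fun x : 'Z_q => Posz (x : nat)) X.

Lemma zliftK (q m n : nat) (X : 'M['Z_q]_(m, n)) : map_mx intr (zlift X) = X.
Proof. by apply/matrixP=> i j; rewrite !mxE [LHS]natr_Zp. Qed.

Lemma intr_Zp_eq0 (q : nat) (z : int) : (1 < q)%N ->
  (z%:~R == 0 :> 'Z_q) = (q%:Z %| z)%Z.
Proof.
move=> q1; have natP n : (n%:R == 0 :> 'Z_q) = (q %| n)%N.
  by rewrite -val_eqE /= val_Zp_nat.
case: z => n; first by rewrite [LHS]natP.
by rewrite NegzE rmorphN oppr_eq0 [LHS]natP.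
Qed.

Lemma intr_mx_Zp_eq0 (q m n : nat) (D : 'M[int]_(m, n)) : (1 < q)%N ->
  map_mx intr D = 0 :> 'M['Z_q]_(m, n) -> D = q%:Z *: map_mx (divz^~ q%:Z) D.
Proof.
move=> q1 /matrixP D0; apply/matrixP=> i j; have /eqP := D0 i j.
by rewrite !mxE intr_Zp_eq0 // mulrC => /divzK ->.
Qed.

Lemma intr_mx_transfer (q m n : nat) (R : nzRingType) (D E : 'M[int]_(m, n)) :
  (1 < q)%N -> q%:R = 0 :> R ->
  map_mx intr D = map_mx intr E :> 'M['Z_q]_(m, n) ->
  map_mx intr D = map_mx intr E :> 'M[R]_(m, n).
Proof.
move=> q1 qR /eqP; rewrite -subr_eq0 -map_mxB => /eqP/(intr_mx_Zp_eq0 q1) DE.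
apply/eqP; rewrite -subr_eq0 -map_mxB DE map_mxZ /=.
by rewrite [_%:~R]qR scale0r.
Qed.

Definition zsol (n : nat) (C : 'M[int]_n) (q : nat) :=
  [set X : 'M['Z_q]_n | (X \in unitmx) && (X *m map_mx intr C *m X == map_mx intr C)].

(** Reduction from [Z/q] to any ring in which [q] vanishes; invertibility is
    transported through a representative of the inverse. *)
Lemma sol_transfer (n q : nat) (R : comUnitRingType) (A B : 'M[int]_n)
    (X : 'M['Z_q]_n) :
  (1 < q)%N -> q%:R = 0 :> R -> X \in unitmx ->
  X *m map_mx intr A *m X = map_mx intr B ->
  map_mx intr (zlift X) \in (unitmx : pred 'M[R]_n) /\
  map_mx intr (zlift X) *m map_mx intr A *m map_mx intr (zlift X) = map_mx intr B :> 'M[R]_n.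
Proof.
move=> q1 qR uX XA; split.
  have XV : map_mx intr (zlift X) *m map_mx intr (zlift (invmx X)) = 1%:M :> 'M[R]_n.
    rewrite -map_mxM -(map_mx1 intr); apply: (intr_mx_transfer q1 qR).
    by rewrite map_mxM !zliftK mulmxV // map_mx1.
  by have [] := mulmx1_unit XV.
by rewrite -!map_mxM; apply: (intr_mx_transfer q1 qR); rewrite !map_mxM !zliftK.
Qed.

Variables (p : nat).
Hypothesis (pr : prime p).

Lemma card_modp_field : #|'F_p| = p.
Proof. exact: card_Fp. Qed.

Lemma expp_gt1 (l : nat) : (0 < l)%N -> (1 < p ^ l)%N.
Proof. by move=> l0; rewrite -{1}(exp1n l) ltn_exp2r // prime_gt1. Qed.

Lemma expp_modp (l : nat) : (0 < l)%N -> (p ^ l)%:R = 0 :> 'F_p.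
Proof. by move=> l0; rewrite natrX (pchar_Fp_0 pr) expr0n gtn_eqF. Qed.

Lemma intr_mx_modp_eq0 (m n : nat) (D : 'M[int]_(m, n)) :
  map_mx intr D = 0 :> 'M['F_p]_(m, n) -> D = p%:Z *: map_mx (divz^~ p%:Z) D.
Proof.
move=> /matrixP D0; apply/matrixP=> i j; have /eqP := D0 i j.
by rewrite !mxE -(dvdz_pcharf (pchar_Fp pr)) mulrC => /divzK ->.
Qed.

Lemma zsol_modp (n l : nat) (C : 'M[int]_n) (X : 'M['Z_(p ^ l)]_n) : (0 < l)%N ->
  X \in zsol C (p ^ l) -> map_mx intr (zlift X) \in selfsol (mx_modp p C).
Proof.
move=> l0; rewrite inE => /andP[uX /eqP XC].
have [uXp XpC] := sol_transfer (expp_gt1 l0) (expp_modp l0) uX XC.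
by rewrite inE uXp XpC eqxx.
Qed.

Lemma card_zsol_base (n : nat) (C : 'M[int]_n) :
  (#|zsol C (p ^ 1)| <= #|selfsol (mx_modp p C)|)%N.
Proof.
apply: (@card_le_inj _ _ _ _ (fun X : 'M['Z_(p ^ 1)]_n => map_mx intr (zlift X))) => [X|X Y _ _ /eqP].
  exact: zsol_modp.
rewrite -subr_eq0 -map_mxB => /eqP/intr_mx_modp_eq0 XY.
apply/eqP; rewrite -[X]zliftK -[Y]zliftK -subr_eq0 -map_mxB XY map_mxZ /=.
have -> : (p%:Z)%:~R = 0 :> 'Z_(p ^ 1).
  by apply/eqP; rewrite intr_Zp_eq0 ?expp_gt1 // expn1.
by rewrite scale0r.
Qed.

Lemma scale_int_mxI (m n : nat) (a : int) (S T : 'M[int]_(m, n)) :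
  a != 0 -> a *: S = a *: T -> S = T.
Proof.
move=> a0 /matrixP ST; apply/matrixP=> i j.
by have := ST i j; rewrite !mxE; apply: mulfI.
Qed.

(** The linearised equation: [Y C Y - X C X = p^l (D C X + X C D + p^l D C D)]
    vanishes modulo [p^(l+1)], and the last term dies modulo [p] since [0 < l]. *)
Lemma anticomm_of_lift (n l : nat) (C : 'M[int]_n) (X Y : 'M['Z_(p ^ l.+1)]_n)
    (D : 'M[int]_n) (Xp := map_mx intr (zlift X) : 'M['F_p]_n) : (0 < l)%N ->
  X \in zsol C (p ^ l.+1) -> Y \in zsol C (p ^ l.+1) ->
  zlift Y = zlift X + (p ^ l)%:Z *: D ->
  invmx Xp *m map_mx intr D \in anticomm (mx_modp p C *m Xp).
Proof.
move=> l0 solX solY YX.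
set T := D *m C *m zlift X + zlift X *m C *m D + (p ^ l)%:Z *: (D *m C *m D).
have YT : zlift Y *m C *m zlift Y = zlift X *m C *m zlift X + (p ^ l)%:Z *: T.
  rewrite YX !mulmxDl !mulmxDr !scalerDr -!scalemxAl -!scalemxAr.
  by rewrite -!addrA; congr (_ + _); rewrite addrCA.
have pT : map_mx intr ((p ^ l)%:Z *: T) = 0 :> 'M['Z_(p ^ l.+1)]_n.
  move/(congr1 (map_mx (intr : int -> 'Z_(p ^ l.+1)))): YT.
  rewrite map_mxD !map_mxM !zliftK.
  move: solX solY; rewrite !inE => /andP[_ /eqP->] /andP[_ /eqP->].
  by move/eqP; rewrite eq_sym -subr_eq0 addrC addKr => /eqP.
have {}pT : map_mx intr T = 0 :> 'M['F_p]_n.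
  have := intr_mx_Zp_eq0 (expp_gt1 (ltn0Sn l)) pT; set S := map_mx _ _.
  rewrite expnSr PoszM -scalerA => /(scale_int_mxI _) -> //.
    by rewrite map_mxZ /= [_%:~R](pchar_Fp_0 pr) scale0r.
  by rewrite eqz_nat expn_eq0 gtn_eqF // prime_gt0.
have {pT} : map_mx intr D *m mx_modp p C *m Xp + Xp *m mx_modp p C *m map_mx intr D = 0.
  move: pT; rewrite /T !map_mxD map_mxZ !map_mxM /= [_%:~R](expp_modp l0) scale0r addr0.
  by [].
have : Xp \in selfsol (mx_modp p C) by apply: zsol_modp.
rewrite inE => /andP[uX /eqP XC]; rewrite inE => DC.
rewrite -addr_eq0 !mulmxA mulmxK //.
have -> : invmx Xp *m map_mx intr D *m mx_modp p C *m Xp + mx_modp p C *m map_mx intr D =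
  invmx Xp *m (map_mx intr D *m mx_modp p C *m Xp + Xp *m mx_modp p C *m map_mx intr D).
  by rewrite mulmxDr !mulmxA mulVmx // mul1mx.
by rewrite DC mulmx0.
Qed.

(** A fibre of the reduction is injected, from a base point [X] of that fibre,
    into the anticommutant of [C X] modulo [p]. *)
Lemma card_zsol_step (n l K : nat) (C : 'M[int]_n) : (0 < l)%N ->
  (forall X : 'M['F_p]_n, X \in selfsol (mx_modp p C) ->
     (#|anticomm (mx_modp p C *m X)| <= K)%N) ->
  (#|zsol C (p ^ l.+1)| <= #|zsol C (p ^ l)| * K)%N.
Proof.
move=> l0 leK; have pl1 := expp_gt1 l0; have pl2 := expp_gt1 (ltn0Sn l).
pose red (X : 'M['Z_(p ^ l.+1)]_n) : 'M['Z_(p ^ l)]_n := map_mx intr (zlift X).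
apply: (@card_le_fibers _ _ _ _ red) => [X solX|Z _].
  have pl0 : (p ^ l.+1)%:R = 0 :> 'Z_(p ^ l).
    by apply/eqP; rewrite [_ == _](intr_Zp_eq0 (p ^ l.+1)%:Z pl1) dvdzE /= dvdn_exp2l.
  move: solX; rewrite inE => /andP[uX /eqP XC].
  by have [uY YC] := sol_transfer pl2 pl0 uX XC; rewrite inE uY YC eqxx.
have [->|[X]] := set_0Vmem [set x in zsol C (p ^ l.+1) | red x == Z]; first by rewrite cards0.
rewrite inE => /andP[solX /eqP redX].
set Xp := map_mx intr (zlift X) : 'M['F_p]_n.
apply: leq_trans (leK Xp (zsol_modp (ltn0Sn l) solX)).
pose D (Y : 'M['Z_(p ^ l.+1)]_n) : 'M[int]_n := map_mx (divz^~ (p ^ l)%:Z) (zlift Y - zlift X).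
have YD (Y : 'M['Z_(p ^ l.+1)]_n) : red Y = Z -> zlift Y = zlift X + (p ^ l)%:Z *: D Y.
  move=> redY; have : map_mx intr (zlift Y - zlift X) = 0 :> 'M['Z_(p ^ l)]_n.
    by rewrite map_mxB -/(red Y) -/(red X) redY redX subrr.
  by move/(intr_mx_Zp_eq0 pl1); rewrite -/(D Y) => <-; rewrite addrC subrK.
apply: (@card_le_inj _ _ _ _ (fun Y : 'M['Z_(p ^ l.+1)]_n => invmx Xp *m map_mx intr (D Y))) => [Y|Y Y'].
  by rewrite inE => /andP[solY /eqP /YD /(anticomm_of_lift l0 solX solY)].
rewrite !inE => /andP[_ /eqP /YD YE] /andP[_ /eqP /YD YE'].
have : Xp \in selfsol (mx_modp p C) by apply: zsol_modp.
rewrite inE => /andP[uX _] /(can_inj (mulKVmx uX)) /eqP.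
rewrite -subr_eq0 -map_mxB => /eqP/intr_mx_modp_eq0 DD.
apply/eqP; rewrite -[Y]zliftK -[Y']zliftK -subr_eq0 -map_mxB YE YE'.
rewrite opprD addrACA addrN add0r -scalerBr DD scalerA map_mxZ /=.
have -> : ((p ^ l)%:Z * p%:Z)%:~R = 0 :> 'Z_(p ^ l.+1).
  by apply/eqP; rewrite intr_Zp_eq0 // -PoszM -expnSr.
by rewrite scale0r.
Qed.
End Lifting.

(** * Stable rank and the bound for X C X = C *)
Lemma nonincreasing_nat_stationary (f : nat -> nat) :
  (forall m, (f m.+1 <= f m)%N) ->
  exists N s, forall m, (N <= m)%N -> f m = s.
Proof.
have [b] := ubnP (f 0%N); elim: b f => // b IHb f lef decf.
have [[m ltm]|stat] := pselect (exists m, (f m < f 0%N)%N).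
  have [||N [s Ns]] := IHb (fun k => f (m + k)%N) => [|k|].
  - by rewrite addn0; lia.
  - by rewrite addnS.
  exists (m + N)%N, s => k lek; have := Ns (k - m)%N; rewrite subnKC; last by lia.
  by apply; lia.
exists 0%N, (f 0%N) => m _; apply/eqP; rewrite eqn_leq; apply/andP; split.
  by elim: m => // m; apply: leq_trans.
by rewrite leqNgt; apply/negP => ltm; apply: stat; exists m.
Qed.

Lemma stable_rank_ultimate (F : finFieldType) (n : nat) (M : 'M[F]_n) :
  ultimate_rank M (stable_rank M).
Proof.
have [|N [s Ns]] := @nonincreasing_nat_stationary (fun m => \rank (M ^+ m)).
  by move=> m; rewrite exprSr -[_ * _]/(_ *m _) mxrankM_maxl.
suff -> : stable_rank M = s by exists N.
rewrite /stable_rank; apply: (lim_near_cst discrete_hausdorff).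
by exists N => // m /= Nm; apply: Ns.
Qed.

(** [(C X)^2 = C (X C X) = C^2], so the even powers have equal ranks, and the
    rank of an odd power lies between those of its even neighbours. *)
Lemma ultimate_rank_selfsol (F : finFieldType) (n s : nat) (C X : 'M[F]_n) :
  X \in selfsol C -> ultimate_rank C s -> ultimate_rank (C *m X) s.
Proof.
rewrite inE => /andP[uX /eqP XC] [N Ns].
have sq : (C *m X) ^+ 2 = C ^+ 2.
  by rewrite !expr2 -[LHS]/(_ *m _) -mulmxA [X *m _]mulmxA XC.
have dec (a b : nat) : (\rank ((C *m X) ^+ (a + b)) <= \rank ((C *m X) ^+ a))%N.
  by rewrite exprD -[_ * _]/(_ *m _) mxrankM_maxl.
have even (a : nat) : (N <= a)%N -> \rank ((C *m X) ^+ (2 * a)) = s.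
  by move=> Na; rewrite exprM sq -exprM Ns //; lia.
exists (2 * N)%N => m Nm; apply/eqP; rewrite eqn_leq; apply/andP; split.
  by rewrite -(even N) // -(subnKC Nm) dec.
by rewrite -(even m) ?mul2n -?addnn ?dec //; lia.
Qed.

Lemma selfsol_zsol_bound (p n l s : nat) (C : 'M[int]_n) :
  prime p -> p <> 2%N -> (0 < l)%N -> ultimate_rank (mx_modp p C) s ->
  let r := \rank (mx_modp p C) in
  let E := (2 * ((n - r) * (n - s)) + s * s)%N in
  (#|zsol C (p ^ l)| ^ 2 <= 4 ^ s * p ^ (l * E))%N /\
  (#|zsol C (p ^ l)| ^ 2 <=
     4 ^ s * p ^ (2 * ((n - r) ^ 2 + (r - s) ^ 2) + s * s + (l - 1) * E))%N.
Proof.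
move=> pr p2 l0 Cs r E; have q3 : (2 < #|'F_p|)%N.
  by rewrite card_modp_field //; have := prime_gt1 pr; lia.
have F2 : 2%:R != 0 :> 'F_p.
  rewrite -(dvdn_pcharf (pchar_Fp pr)) gtnNdvd //; have := prime_gt1 pr; lia.
have leK X : X \in selfsol (mx_modp p C) ->
    (#|anticomm (mx_modp p C *m X)| ^ 2 <= p ^ E)%N.
  move=> solX; have := anticomm_bound F2 (ultimate_rank_selfsol solX Cs).
  rewrite card_modp_field // mxrankMfree //.
  by move: solX; rewrite inE row_free_unit => /andP[].
pose K := (\max_(X in selfsol (mx_modp p C)) #|anticomm (mx_modp p C *m X)|)%N.
have K2 : (K ^ 2 <= p ^ E)%N.
  rewrite /K; elim/big_ind: _ => [|x y Hx Hy|X solX]; last exact: leK.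
    by rewrite exp0n.
  by rewrite /maxn; case: ifP.
have step (k : nat) : (#|zsol C (p ^ k.+1)| <= #|selfsol (mx_modp p C)| * K ^ k)%N.
  elim: k => [|k IHk]; first by rewrite muln1 card_zsol_base.
  rewrite (expnSr K) mulnA; apply: leq_trans (leq_mul IHk (leqnn K)).
  apply: card_zsol_step => // X solX.
  exact: (leq_bigmax_cond (F := fun X => #|anticomm (mx_modp p C *m X)|)).
have bound (e : nat) : (#|selfsol (mx_modp p C)| ^ 2 <= 4 ^ s * p ^ e)%N ->
    (#|zsol C (p ^ l)| ^ 2 <= 4 ^ s * p ^ (e + (l - 1) * E))%N.
  move=> base; rewrite -(prednK l0) subn1 /=.
  apply: (@leq_trans ((#|selfsol (mx_modp p C)| * K ^ l.-1) ^ 2)); first by rewrite leq_exp2r.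
  have -> : ((#|selfsol (mx_modp p C)| * K ^ l.-1) ^ 2 =
      #|selfsol (mx_modp p C)| ^ 2 * (K ^ 2) ^ l.-1)%N.
    by rewrite (expnMn _ (K ^ l.-1)) -!expnM (mulnC 2).
  rewrite (expnD p e) mulnA (mulnC l.-1) (expnM p E); apply: leq_mul => //.
  by case: l.-1 => [|k]; rewrite ?expn0 // leq_exp2r.
have [B1 B2] := selfsol_bound q3 Cs; rewrite card_modp_field // in B1 B2.
split; last exact: bound B2.
have -> : (l * E = E + (l - 1) * E)%N by rewrite -mulSn subn1 prednK.
exact: bound B1.
Qed.

(** * From a pair of matrices to a single one *)
Lemma Nstar_self (n q : nat) (C : 'M[int]_n) : Nstar C C q = #|zsol C q|.
Proof.
apply: eq_card => X; rewrite !inE; case uX: (X \in unitmx) => //=.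
rewrite -(inj_eq (can_inj (mulKmx uX))) mulKVmx // mulmxA.
by [].
Qed.

Lemma Nstar_translate (n q : nat) (A B : 'M[int]_n) (X0 : 'M['Z_q]_n) :
  X0 \in unitmx -> X0 *m map_mx intr A *m X0 = map_mx intr B ->
  (Nstar A B q <= #|zsol (zlift X0 *m A) q|)%N.
Proof.
move=> uX0 XA; rewrite /Nstar.
apply: (@card_le_inj 'M['Z_q]_n 'M['Z_q]_n _ _ (fun X => X *m invmx X0)) => [X|X Y _ _]; last first.
  exact: (can_inj (mulmxKV uX0)).
rewrite !inE => /andP[uX /eqP AX]; rewrite unitmx_mul uX unitmx_inv uX0 /=.
rewrite map_mxM zliftK mulmxA mulmxKV //.
have {}AX : X *m map_mx intr A *m X = map_mx intr B.
  by rewrite -mulmxA AX mulKVmx.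
by rewrite mulmxA AX -XA mulmxK.
Qed.

Lemma Nstar_empty_or_sol (n q : nat) (A B : 'M[int]_n) :
  Nstar A B q = 0%N \/
  exists2 X0 : 'M['Z_q]_n, X0 \in unitmx & X0 *m map_mx intr A *m X0 = map_mx intr B.
Proof.
rewrite /Nstar; set S := [set _ | _]; have [->|[X]] := set_0Vmem S.
  by left; rewrite cards0.
rewrite inE => /andP[uX /eqP AX]; right; exists X => //.
by rewrite -mulmxA AX mulKVmx.
Qed.

(** The integer matrix [zlift X *m A], for one solution [X], plays the role of
    [C]; its stable rank depends on more than [A], which is why only [s <= r] is
    recorded. *)
Lemma Nstar_bound (p n l : nat) (A B : 'M[int]_n) :
  prime p -> p <> 2%N -> (0 < l)%N -> Nstar A B (p ^ l) = 0%N \/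
  let r := \rank (mx_modp p A) in
  (exists2 X : 'M['F_p]_n, X \in unitmx & X *m mx_modp p A *m X = mx_modp p B) /\
  exists2 s, (s <= r)%N &
    (Nstar A B (p ^ l) ^ 2 <= 4 ^ s * p ^ (l * (2 * ((n - r) * (n - s)) + s * s)))%N.
Proof.
move=> pr p2 l0; have [->|[X uX XA]] := Nstar_empty_or_sol (p ^ l) A B; first by left.
right; have [uXp XpA] := sol_transfer (expp_gt1 pr l0) (expp_modp pr l0) uX XA.
split; first by exists (map_mx intr (zlift X)).
have eC : mx_modp p (zlift X *m A) = map_mx intr (zlift X) *m mx_modp p A.
  exact: map_mxM.
have rC : \rank (mx_modp p (zlift X *m A)) = \rank (mx_modp p A).
  by rewrite eC eqmxMfull // row_full_unit.
have Cs := stable_rank_ultimate (mx_modp p (zlift X *m A)).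
exists (stable_rank (mx_modp p (zlift X *m A))).
  by rewrite -rC; apply: ultimate_rank_le.
have [bound _] := selfsol_zsol_bound pr p2 l0 Cs; rewrite rC in bound.
apply: leq_trans bound; rewrite leq_exp2r //; exact: Nstar_translate.
Qed.

(** * Comparison of exponents *)
Lemma exponent_small_rank (n r s : nat) : (s <= r)%N -> (2 * r <= n)%N ->
  (2 * ((n - r) * (n - s)) + s * s <= 2 * (n * (n - r)))%N.
Proof.
move=> sr rn; have [c ->] : exists c, n = (r + r + c)%N by exists (n - r - r)%N; lia.
have [d ->] : exists d, r = (s + d)%N by exists (r - s)%N; lia.
have -> : (s + d + (s + d) + c - (s + d) = s + d + c)%N by lia.
have -> : (s + d + (s + d) + c - s = s + d + d + c)%N by lia.
nia.
Qed.

Lemma exponent_large_rank (n r s : nat) : (s <= r)%N -> (r <= n)%N -> (n <= 2 * r)%N ->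
  (2 * ((n - r) * (n - s)) + s * s <= n * n)%N.
Proof.
move=> sr rn nr; have [c en] : exists c, n = (r + c)%N by exists (n - r)%N; lia.
have [d er] : exists d, r = (s + d)%N by exists (r - s)%N; lia.
have -> : (n - r = c)%N by lia.
have -> : (n - s = d + c)%N by lia.
rewrite en er; nia.
Qed.

Section RealBounds.
Variable R : realType.

Lemma le_of_sqr_le (N s M p : nat) : (N ^ 2 <= 4 ^ s * p ^ M)%N ->
  N%:R <= 2 ^+ s * p%:R `^ (M%:R / 2) :> R.
Proof.
move=> NM; rewrite -(@ler_pXn2r _ 2) ?nnegrE ?mulr_ge0 ?exprn_ge0 ?powR_ge0 //.
rewrite exprMn -exprM mulnC exprM -[_ `^ _ ^+ 2]powR_mulrn ?powR_ge0 // -powRrM.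
rewrite divfK ?pnatr_eq0 // powR_mulrn // -natrX -!natrX -natrM ler_nat.
by [].
Qed.

End RealBounds.

Lemma Nstar_bound_weaken (p N s t M M' : nat) : prime p -> (s <= t)%N -> (M <= M')%N ->
  (N ^ 2 <= 4 ^ s * p ^ M)%N -> (N ^ 2 <= 4 ^ t * p ^ M')%N.
Proof.
move=> pr st MM /leq_trans; apply; apply: leq_mul; first by rewrite leq_pexp2l.
by rewrite leq_pexp2l // prime_gt0.
Qed.

(** * The three bounds *)
Theorem theorem1p6 (R : realType) (p n l : nat)
    (hp : prime p) (hp2 : p <> 2%N) (hn : (1 <= n)%N) (hl : (1 <= l)%N) :
  (forall (C : 'M[int]_n) (r r_oo : nat),
     r = \rank (mx_modp p C) -> r_oo = stable_rank (mx_modp p C) ->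
     (Nstar C C (p ^ l))%:R <=
       2 ^+ r_oo * p%:R `^ exponent_e R l n r r_oo :> R)
  /\
  (forall (A B : 'M[int]_n) (r : nat),
     r = \rank (mx_modp p A) -> r = \rank (mx_modp p B) -> (0 < r)%N ->
     (Nstar A B (p ^ l))%:R <=
       2 ^+ r * (if r%:R <= n%:R / 2 :> R
                 then p%:R `^ (l%:R * n%:R * (n%:R - r%:R))
                 else p%:R `^ (l%:R * n%:R ^+ 2 / 2)) :> R)
  /\
  (forall A B : 'M[int]_n,
     ((1 < n)%N ->
      ~ (forall i j : 'I_n, (p %| A i j)%Z /\ (p %| B i j)%Z) ->
      (Nstar A B (p ^ l))%:R <=
        2 ^+ n * p%:R `^ (l%:R * (n%:R ^+ 2 - n%:R)) :> R)
     /\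
     (gcdz (gcdz (\det A) (\det B)) p = 1 ->
      (Nstar A B (p ^ l))%:R <=
        2 ^+ n * p%:R `^ (l%:R * n%:R ^+ 2 / 2) :> R)).
Proof.
have zero (N s : nat) (x : R) : N = 0%N -> N%:R <= 2 ^+ s * p%:R `^ x :> R.
  by move=> ->; rewrite mulr_ge0 ?exprn_ge0 ?powR_ge0.
split; last split.
- move=> C r s rC sC; have Cs : ultimate_rank (mx_modp p C) s.
    by rewrite sC; apply: stable_rank_ultimate.
  have [_] := selfsol_zsol_bound hp hp2 hl Cs.
  rewrite Nstar_self -rC => /(le_of_sqr_le R); congr (_ <= _ * _ `^ _).
  have sr : (s <= r)%N by rewrite rC; apply: ultimate_rank_le.
  have rn : (r <= n)%N by rewrite rC rank_leq_row.
  have sn := leq_trans sr rn.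
  rewrite /exponent_e !(natrD, natrM, natrB, natrX) //.
  by field.
- move=> A B r rA _ _; have rn : (r <= n)%N by rewrite rA rank_leq_row.
  have -> : (r%:R <= n%:R / 2 :> R) = (2 * r <= n)%N.
    by rewrite ler_pdivlMr // -natrM ler_nat mulnC.
  have [N0|] := Nstar_bound A B hp hp2 hl; first by case: ifP => _; apply: zero.
  rewrite -rA => -[_ [s sr bound]]; case: leqP => nr.
    have M : (l * (2 * ((n - r) * (n - s)) + s * s) <= l * (2 * (n * (n - r))))%N.
      by rewrite leq_mul2l exponent_small_rank ?orbT.
    have := le_of_sqr_le R (Nstar_bound_weaken hp sr M bound); congr (_ <= _ * _ `^ _).
    by rewrite !(natrM, natrB) //; field.
  have M : (l * (2 * ((n - r) * (n - s)) + s * s) <= l * (n * n))%N.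
    by rewrite leq_mul2l exponent_large_rank ?orbT // ltnW.
  have := le_of_sqr_le R (Nstar_bound_weaken hp sr M bound); congr (_ <= _ * _ `^ _).
  by rewrite !natrM expr2.
move=> A B; have [N0|] := Nstar_bound A B hp hp2 hl; first by split=> *; apply: zero.
set r := \rank _; have rn : (r <= n)%N := rank_leq_row _.
move=> [[X uX XA] [s sr bound]]; have sn := leq_trans sr rn; split.
  move=> n1 nAB; have r0 : (0 < r)%N.
    rewrite lt0n mxrank_eq0; apply/eqP => A0; apply: nAB => i j.
    rewrite !(dvdz_pcharf (pchar_Fp hp)).
    have B0 : mx_modp p B = 0 by rewrite -XA A0 mulmx0 mul0mx.
    by move/matrixP: A0 => /(_ i j); move/matrixP: B0 => /(_ i j); rewrite !mxE => -> ->.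
  have M : (l * (2 * ((n - r) * (n - s)) + s * s) <= l * (2 * (n * (n - 1))))%N.
    rewrite leq_mul2l; apply/orP; right; have [nr|nr] := leqP (2 * r) n.
      by apply: leq_trans (exponent_small_rank sr nr) _; rewrite !leq_mul2l leq_sub2l ?orbT.
    apply: leq_trans (exponent_large_rank sr rn (ltnW nr)) _.
    by rewrite mulnCA leq_mul2l; apply/orP; right; lia.
  have := le_of_sqr_le R (Nstar_bound_weaken hp sn M bound); congr (_ <= _ * _ `^ _).
  by rewrite !(natrM, natrB) //; field.
move=> gAB; have fr : r = n.
  apply: mxrank_unit; rewrite unitmxE unitfE det_map_mx; apply/eqP => /= dA.
  have dB : (\det B)%:~R = 0 :> 'F_p.
    by rewrite -det_map_mx -[map_mx _ B]XA !det_mulmx [\det (mx_modp p A)]det_map_mx /= dA mulr0 mul0r.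
  have : (p %| gcdz (gcdz (\det A) (\det B)) p)%Z.
    by rewrite !dvdz_gcd !(dvdz_pcharf (pchar_Fp hp)) dA dB [_%:~R](pchar_Fp_0 hp) eqxx.
  by rewrite gAB dvdz1 /=; have := prime_gt1 hp; case: (p) => [|[]].
have M : (l * (2 * ((n - r) * (n - s)) + s * s) <= l * (n * n))%N.
  by rewrite leq_mul2l exponent_large_rank ?orbT // fr; lia.
have := le_of_sqr_le R (Nstar_bound_weaken hp sn M bound); congr (_ <= _ * _ `^ _).
by rewrite !natrM expr2.
Qed.
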